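(* Every SBEP graph $G$ is prism-hamiltonian, i.e., $G\Box K_2$ has a hamiltonian cycle.
   Context: A simple block EP (SBEP) graph is a connected finite simple graph $H$ such that (i) each block of $H$ is either an even cycle or a single edge, and (ii) each vertex of $H$ lies in at most two blocks. The prism $G\Box K_2$ consists of two copies of $G$ with the two copies of each vertex joined by an edge. *)

(* Defs.v *)
From mathcomp Require Import all_boot.

Set Implicit Arguments.
Unset Strict Implicit.
Unset Printing Implicit Defensive.

(* A finite simple graph is a symmetric irreflexive relation e on a finType. *)

Section Graphs.
Variables (T : finType) (e : rel T).

Definition connected_graph : Prop := 0 < #|T| /\ forall x y : T, connect e x y.

Definition induced (A : {set T}) : rel T :=
  [rel x y | [&& x \in A, y \in A & e x y]].

Definition connected_in (A : {set T}) : bool :=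
  (A != set0) && [forall x in A, forall y in A, connect (induced A) x y].

(* v separates two other vertices of the same component of the subgraph
   induced by A. *)
Definition cutvertex_in (A : {set T}) (v : T) : bool :=
  (v \in A) &&
  [exists x in A :\ v, exists y in A :\ v,
     connect (induced A) x y && ~~ connect (induced (A :\ v)) x y].

Definition nonseparable (A : {set T}) : bool :=
  connected_in A && [forall v, ~~ cutvertex_in A v].

(* A block is a maximal connected subgraph without a cutvertex.  Adding edges
   on the same vertices keeps a graph connected and creates no cutvertex, so
   blocks are induced subgraphs and are represented by their vertex sets.  The
   block of an isolated vertex is a singleton, hence K_1 is not SBEP. *)
Definition block (B : {set T}) : bool := maxset nonseparable B.

Definition is_single_edge (B : {set T}) : Prop :=
  exists x y : T, e x y /\ B = [set x; y].

(* c lists the vertices of the induced subgraph in cyclic order; the last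
   clause says that its edges are exactly those of the cycle. *)
Definition is_even_cycle (B : {set T}) : Prop :=
  exists c : seq T,
    [/\ uniq c, 2 < size c, ~~ odd (size c), c =i B &
        {in B &, forall x y, e x y = (y == next c x) || (x == next c y)}].

Definition SBEP : Prop :=
  [/\ connected_graph,
      forall B : {set T}, block B -> is_even_cycle B \/ is_single_edge B &
      forall x : T, #|[set B : {set T} | block B & x \in B]| <= 2].

Definition hamiltonian : Prop :=
  exists c : seq T, [/\ ucycle e c, 2 < size c & forall x : T, x \in c].

End Graphs.

Definition cartesian_product (T U : finType) (e : rel T) (f : rel U) :
    rel (T * U) :=
  [rel u v | (u.1 == v.1) && f u.2 v.2 || e u.1 v.1 && (u.2 == v.2)].

Definition K2 : rel bool := [rel a b | a != b].

Definition prism (T : finType) (e : rel T) : rel (T * bool) :=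
  cartesian_product e K2.

(* Main.v *)
Require Import Defs.
From mathcomp Require Import all_boot.

(** If a cutvertex [v] splits the graph into two parts, then the blocks of each
part are blocks of the whole, so [v] lies in exactly one block of each part.
Induction therefore yields the stronger claim that the prism has a hamiltonian
cycle using the vertical edge at every vertex that lies in a single block:
for a single block (an edge or an even cycle) one zigzags between the layers,
taking all vertical edges, and two parts meeting at [v] are combined by deleting
the vertical edge at [v] from both cycles and joining the resulting paths. *)

Set Implicit Arguments.
Unset Strict Implicit.
Unset Printing Implicit Defensive.

(** * Successors in a concatenated cyclic list *)

Section NextAt.
Variable T : eqType.
Implicit Types (x y z w : T) (s t : seq T).

(** The last entry before [w] is followed by [w], so [w] takes over the role of the closing default.
    With [next_at_catr], this carries successors from two cycles over to the cycle glued from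
    them. *)
Lemma next_at_catl x y z w s t :
  x \in y :: s -> next_at x z y (s ++ w :: t) = next_at x w y s.
Proof.
elim: s y => [|a s IHs] y /=; first by rewrite inE => ->.
by rewrite inE; case: eqP => //= _; apply: IHs.
Qed.

Lemma next_at_catr x y z w s t :
  x \notin y :: s -> next_at x z y (s ++ w :: t) = next_at x z w t.
Proof.
elim: s y => [|a s IHs] y /=; first by rewrite inE => /negPf->.
by rewrite inE negb_or => /andP[/negPf-> /IHs].
Qed.

End NextAt.

(** * Blocks of induced subgraphs *)

Section Blocks.
Variables (T : finType) (e : rel T).
Hypotheses (e_sym : symmetric e) (e_irr : irreflexive e).
Implicit Types (A B C D : {set T}) (v x y z : T).

(** Nonseparability of [C] depends only on the edges inside [C], so the blocks of the subgraph
    induced by [A] can be described with [e] itself. *)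
Definition blocks_in A : {set {set T}} :=
  [set B | maxset (fun C => nonseparable e C && (C \subset A)) B].

Lemma blocks_inP A B :
  reflect ([/\ nonseparable e B, B \subset A &
              forall C, nonseparable e C -> C \subset A -> B \subset C -> C = B])
          (B \in blocks_in A).
Proof.
rewrite inE; apply: (iffP maxsetP) => [[/andP[nB sBA] maxB]|[nB sBA maxB]].
  by split=> // C nC sCA; apply: maxB; rewrite nC.
by split=> [|C /andP[nC sCA]]; [rewrite nB | apply: maxB].
Qed.

Lemma blocks_inT B : (B \in blocks_in setT) = block e B.
Proof.
apply/blocks_inP/maxsetP => [[nB _ maxB]|[nB maxB]].
  by split=> // C nC; apply: maxB.
by split=> // C nC _; apply: maxB.
Qed.

Lemma nonseparable_in_block A B :
  nonseparable e B -> B \subset A -> exists2 C, C \in blocks_in A & B \subset C.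
Proof.
move=> nB sBA.
have [|C maxC sBC] :=
  @maxset_exists _ (fun C => nonseparable e C && (C \subset A)) B.
  by rewrite nB.
by exists C; rewrite // inE.
Qed.

Lemma induced_sym A : symmetric (induced e A).
Proof. by move=> x y; rewrite /induced /= e_sym; apply/and3P/and3P=> -[]; split. Qed.

Lemma connect_induced_sym A : connect_sym (induced e A).
Proof. exact/sym_connect_sym/induced_sym. Qed.

Lemma connected_inP A :
  reflect ((exists x, x \in A) /\ {in A &, forall x y, connect (induced e A) x y})
          (connected_in e A).
Proof.
apply: (iffP andP) => [[/set0Pn nA /forall_inP cA]|[nA cA]]; split=> //.
- by move=> x y xA yA; move/forall_inP: (cA x xA); apply.
- exact/set0Pn.
by apply/forall_inP=> x xA; apply/forall_inP=> y yA; apply: cA.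
Qed.

Lemma nonseparable1 x : nonseparable e [set x].
Proof.
apply/andP; split.
  apply/connected_inP; split=> [|y z]; first by exists x; rewrite inE.
  by rewrite !inE => /eqP-> /eqP->.
apply/forallP=> v; apply/negP=> /andP[]; rewrite inE => /eqP->.
by case/exists_inP=> y; rewrite setDv inE.
Qed.

Lemma nonseparable2 x y : e x y -> nonseparable e [set x; y].
Proof.
move=> exy; apply/andP; split.
  apply/connected_inP; split=> [|a b]; first by exists x; rewrite !inE eqxx.
  rewrite !inE => /orP[]/eqP-> /orP[]/eqP-> //; apply: connect1.
    by rewrite /induced /= !inE !eqxx orbT.
  by rewrite /induced /= !inE !eqxx orbT /= e_sym.
apply/forallP=> v; apply/negP=> /andP[vxy].
case/exists_inP=> a; rewrite !inE => /andP[av axy].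
case/exists_inP=> b; rewrite !inE => /andP[bv bxy] /andP[_ /negP[]].
suff -> : a = b by [].
move: vxy av bv; rewrite !inE => /orP[]/eqP->.
  by case/orP: axy => /eqP->; case/orP: bxy => /eqP->; rewrite ?eqxx.
by case/orP: axy => /eqP->; case/orP: bxy => /eqP->; rewrite ?eqxx.
Qed.

(** * Splitting at a vertex [v]: [D] is a union of components of [A :\ v] *)

Section Split.
Variables (A D : {set T}) (v : T).
Hypotheses (vA : v \in A) (cA : connected_in e A).
Hypotheses (sDA : D \subset A :\ v) (nD : D != set0).
Hypothesis clD : forall x y, x \in D -> y \in A :\ v -> e x y -> y \in D.

Lemma split_part_sub : v |: D \subset A.
Proof.
rewrite subUset sub1set vA /=.
exact: subset_trans sDA (subsetDl _ _).
Qed.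

(** A path in [A] from [D] to [v] cannot leave [D] before it first meets [v], so every vertex of [D]
    reaches [v] inside the part. *)
Lemma connected_split_part : connected_in e (v |: D).
Proof.
have tov x : x \in D -> connect (induced e (v |: D)) x v.
  move=> xD; have /setD1P[_ xA] := subsetP sDA _ xD.
  have /connected_inP[_ /(_ x v xA vA)/connectP[p pP lP]] := cA.
  elim: p x xD {xA} pP lP => [|y p IHp] x xD /=; first by move=> _ ->.
  case/andP=> /and3P[xA yA exy] pP lP.
  have xyv : y \in v |: D -> connect (induced e (v |: D)) x y.
    by move=> yvD; apply: connect1; rewrite /induced /= !inE xD orbT exy andbT; rewrite !inE in yvD.
  have [yv|yv] := eqVneq y v; first by move: xyv; rewrite yv; apply; rewrite !inE eqxx.
  have yD : y \in D by apply: clD xD _ exy; rewrite !inE yv.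
  apply: connect_trans (IHp y yD pP lP).
  by apply: xyv; rewrite !inE yD orbT.
have tov' x : x \in v |: D -> connect (induced e (v |: D)) x v.
  by case/setU1P=> [->|/tov].
apply/connected_inP; split=> [|x y xD yD]; first by exists v; rewrite !inE eqxx.
by apply: connect_trans (tov' x xD) _; rewrite connect_induced_sym; apply: tov'.
Qed.

Lemma split_vertex_neighbor : exists2 y, y \in D & e v y.
Proof.
have /set0Pn[x xD] := nD.
have /setD1P[xv xA] := subsetP sDA _ xD.
have /connected_inP[_ /(_ v x)] := connected_split_part.
rewrite !inE eqxx xD orbT => /(_ isT isT)/connectP[[|y p] /=].
  by move=> _ xvE; rewrite xvE eqxx in xv.
case/andP=> /and3P[_ /setU1P[->|yD] evy] _ _; first by rewrite e_irr in evy.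
by exists y.
Qed.

(** If [C] had a vertex [x] in [D] and a vertex [y] outside [v |: D], every path in [C] between them
    would pass through [v], making [v] a cutvertex of [C]. *)
Lemma nonseparable_split C :
  nonseparable e C -> C \subset A -> (C \subset v |: D) || (C \subset A :\: D).
Proof.
case/andP=> /connected_inP[_ cC] /forallP/(_ v) ncut sCA.
apply/norP=> -[/subsetPn[y yC yD] /subsetPn[x xC xD]].
have {}xD : x \in D by move: xD; rewrite !inE (subsetP sCA) // andbT negbK.
move: yD; rewrite !inE negb_or => /andP[yv yD].
have /setD1P[xv xA] := subsetP sDA _ xD.
have /connectP[p pP lP] := cC x y xC yC.
have vC : v \in C.
  (* A path in [C] that starts in [D] and avoids [v] stays in [D], so it could not end at [y]. *)
  apply: contraNT yD => vC; rewrite {cC xC ncut xv xA yv}lP {yC y}.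
  elim: p x xD pP => //= z p IHp x xD /andP[/and3P[_ zC exz]].
  apply: IHp; apply: clD xD _ exz; rewrite !inE (subsetP sCA) // andbT.
  by apply: contraNneq vC => <-.
case/negP: ncut; rewrite /cutvertex_in vC; apply/exists_inP; exists x; rewrite ?inE ?xv //.
apply/exists_inP; exists y; rewrite ?inE ?yv // cC //=.
apply/negP=> /connectP[q qP lq]; case/negP: yD; rewrite {}lq.
elim: q x xD qP {xC xv xA lP pP} => //= z q IHq x xD /andP[/and3P[_ zC exz]].
apply: IHq; apply: clD xD _ exz.
by apply: subsetP zC; apply: setSD.
Qed.

(** By [nonseparable_split], a larger nonseparable set stays in [v |: D] unless [B] lies on the
    other side; maximality in the part then gives maximality in [A]. The second conclusion keeps the
    blocks of the two parts distinct. *)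
Lemma blocks_in_split_part B : B \in blocks_in (v |: D) ->
  B \in blocks_in A /\ ~~ (B \subset A :\: D).
Proof.
case/blocks_inP=> nB sBD maxB.
have nsB : ~~ (B \subset A :\: D).
  apply/negP=> sB.
  have [y yD evy] := split_vertex_neighbor.
  (* Lying on both sides, [B] has at most the vertex [v]; the edge from [v] to its neighbour [y] in
     [D] is then a nonseparable set containing it, against maximality. *)
  have sBv : B \subset [set v; y].
    apply/subsetP=> x xB; have := subsetP sBD x xB; have := subsetP sB x xB.
    by rewrite !inE => /andP[/negPf-> _]; rewrite orbF => ->.
  have yB : y \in B.
    rewrite -(maxB _ (nonseparable2 evy)) // ?inE ?eqxx ?orbT //.
    by apply/subsetP=> x; rewrite !inE => /orP[]/eqP->; rewrite ?eqxx ?yD ?orbT.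
  by have := subsetP sB y yB; rewrite inE yD.
split=> //; apply/blocks_inP; split=> //.
  exact: subset_trans sBD split_part_sub.
move=> C nC sCA sBC; case/orP: (nonseparable_split nC sCA) => sC.
  exact: maxB.
by case/negP: nsB; apply: subset_trans sC.
Qed.

Lemma split_vertex_in_block : exists2 B, B \in blocks_in (v |: D) & v \in B.
Proof.
have [||B BD] := @nonseparable_in_block (v |: D) [set v].
- exact: nonseparable1.
- by rewrite sub1set !inE eqxx.
by rewrite sub1set; exists B.
Qed.

End Split.
End Blocks.

(** * Prism cycles with prescribed vertical edges *)

Section Prism.
Variables (T : finType) (e : rel T).
Hypotheses (e_sym : symmetric e) (e_irr : irreflexive e).
Implicit Types (A B D : {set T}) (x y z v : T) (b : bool).

Lemma prism_sym : symmetric (prism e).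
Proof.
move=> [x a] [y b]; rewrite /prism /cartesian_product /K2 /=.
by rewrite e_sym (eq_sym x) (eq_sym a).
Qed.

(** The layer [b] is left open because the cycle may traverse the edge in either direction. *)
Definition vertical_edge (c : seq (T * bool)) v :=
  exists b, next c (v, b) = (v, ~~ b).

Definition prism_cycle A (c : seq (T * bool)) :=
  [/\ ucycle (prism e) c, 2 < size c & forall x b, ((x, b) \in c) = (x \in A)].

Definition simple_vertex A v :=
  #|[set B in blocks_in e A | v \in B]| <= 1.

Definition good A := exists2 c, prism_cycle A c &
  {in A, forall v, simple_vertex A v -> vertical_edge c v}.

(** Each vertex is entered in the layer where the previous one was left, so steps alternate between
    vertical and horizontal edges. *)
Fixpoint zigzag b (s : seq T) : seq (T * bool) :=
  if s is x :: s' then [:: (x, b), (x, ~~ b) & zigzag (~~ b) s'] else [::].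

Lemma mem_zigzag b s x a : ((x, a) \in zigzag b s) = (x \in s).
Proof.
elim: s b => //= y s IHs b; rewrite !inE IHs !xpair_eqE.
by case: (x == y) => //=; case: b; case: (a).
Qed.

Lemma size_zigzag b s : size (zigzag b s) = (size s).*2.
Proof. by elim: s b => //= x s IHs b; rewrite IHs. Qed.

Lemma zigzag_uniq b s : uniq (zigzag b s) = uniq s.
Proof.
elim: s b => //= x s IHs b; rewrite inE !mem_zigzag IHs xpair_eqE eqxx /=.
by case: b; case: (x \in s).
Qed.

Lemma path_zigzag x b s : path e x s -> path (prism e) (x, b) (zigzag b s).
Proof.
elim: s x b => //= y s IHs x b /andP[exy /IHs ->].
by rewrite /prism /cartesian_product /K2 /= exy !eqxx /= orbT; case: b.
Qed.

Lemma last_zigzag x b s :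
  last (x, b) (zigzag b s) = (last x s, b (+) odd (size s)).
Proof.
elim: s x b => [|y s IHs] x b /=; first by rewrite addbF.
by rewrite IHs addNb addbN.
Qed.

(** Every vertex switches the layer once; an even number of switches returns to layer [b], so the
    closing edge is horizontal. *)
Lemma cycle_zigzag b s :
  ~~ odd (size s) -> cycle e s -> cycle (prism e) (zigzag b s).
Proof.
case: s => //= x s; rewrite negbK => os.
rewrite !rcons_path => /andP[pP elx].
rewrite path_zigzag // last_zigzag os addbT negbK.
by rewrite /prism /cartesian_product /K2 /= elx !eqxx orbT; case: b.
Qed.

Lemma vertical_edge_zigzag b s v : v \in s -> vertical_edge (zigzag b s) v.
Proof.
(* Generalised to a suffix [t] of the list for induction: [y] is the entry just before it and [y0]
   the closing default, which is never returned since both copies of [v] occur consecutively in the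
   suffix. *)
have nextz (y0 y : T * bool) a t : v \in t -> y.1 != v ->
    exists d, next_at (v, d) y0 y (zigzag a t) = (v, ~~ d).
  elim: t a y => //= x t IHt a [y b'] /= vxt yv.
  have vy d : ((v, d) == (y, b')) = false.
    by rewrite xpair_eqE eq_sym (negPf yv).
  have [xv|xv] := eqVneq x v; first by exists a; rewrite vy xv eqxx.
  rewrite inE eq_sym (negPf xv) /= in vxt.
  have [d dP] := IHt (~~ a) (x, ~~ a) vxt xv.
  by exists d; rewrite vy xpair_eqE eq_sym (negPf xv).
case: s => // x s; rewrite /vertical_edge /= inE => vxs.
have [xv|xv] := eqVneq x v; first by exists b; rewrite xv eqxx.
rewrite eq_sym (negPf xv) /= in vxs.
have [d dP] := nextz (x, b) (x, ~~ b) (~~ b) s vxs xv.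
by exists d; rewrite xpair_eqE eq_sym (negPf xv).
Qed.

(** The bound [1 < size s] admits a single edge, read as a closed walk of length two; its zigzag is
    the 4-cycle over that edge. *)
Lemma good_even_cycle A s : uniq s -> 1 < size s -> ~~ odd (size s) ->
  s =i A -> cycle e s -> good A.
Proof.
move=> us s1 os sA cs; exists (zigzag false s).
  split=> [||x b]; last by rewrite mem_zigzag sA.
    by rewrite /ucycle cycle_zigzag ?zigzag_uniq.
  by rewrite size_zigzag; case: size s1 => [|[]].
by move=> v vA _; apply: vertical_edge_zigzag; rewrite sA.
Qed.

Lemma good_block A : is_even_cycle e A \/ is_single_edge e A -> good A.
Proof.
case=> [[s [us s2 os sA eA]]|[x [y [exy ->]]]].
  apply: (good_even_cycle us) => //; first exact: ltnW.
  apply: cycle_from_next => // x xs.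
  by rewrite eA -?sA ?mem_next // eqxx.
apply: (@good_even_cycle _ [:: x; y]) => //=.
- by rewrite inE andbT; apply: contraTneq exy => ->; rewrite e_irr.
- by move=> z; rewrite !inE.
by rewrite exy e_sym exy.
Qed.

(** * Gluing two prism cycles at a common vertex *)

Lemma prism_cycle_start A c v b : prism_cycle A c -> v \in A ->
  vertical_edge c v ->
  exists s, prism_cycle A [:: (v, b), (v, ~~ b) & s] /\
    forall x, vertical_edge c x -> vertical_edge [:: (v, b), (v, ~~ b) & s] x.
Proof.
(* If the vertical edge at [v] is traversed the other way, the reversed cycle is used; reversal and
   rotation preserve all vertical edges. *)
wlog nextb : c / next c (v, b) = (v, ~~ b).
  move=> IH cA vA [a nexta]; have [ab|ab] := eqVneq a b.
    by apply: (IH c) => //; [rewrite -ab | exists a].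
  have [/andP[cc uc] sc mc] := cA.
  have cr : prism_cycle A (rev c).
    split; rewrite ?size_rev //; last by move=> x d; rewrite mem_rev mc.
    rewrite /ucycle rev_uniq uc andbT rev_cycle.
    by rewrite (@eq_cycle _ _ (prism e)) // => x y; apply: prism_sym.
  have vr x : vertical_edge c x -> vertical_edge (rev c) x.
    case=> d nextd; exists (~~ d).
    by rewrite next_rev // -nextd prev_next // negbK.
  have [||s [sA sP]] := IH (rev c) _ cr vA.
  - rewrite next_rev //.
    have -> : (v, b) = next c (v, a) by rewrite nexta; case: a b ab {IH nexta} => [] [].
    by rewrite prev_next //; case: a b ab {IH nexta} => [] [].
  - by apply: vr; exists a.
  by exists s; split=> // x /vr/sP.
move=> [/andP[cc uc] sc mc] vA _.
have vc : (v, b) \in c by rewrite mc.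
case: (rot_to vc) => i s def_s.
have rotA : prism_cycle A (rot i c).
  split; rewrite ?size_rot //; last by move=> x d; rewrite mem_rot mc.
  by rewrite /ucycle rot_cycle rot_uniq cc.
have rotv x : vertical_edge c x -> vertical_edge (rot i c) x.
  by case=> d nextd; exists d; rewrite next_rot.
have := nextb; rewrite -(next_rot i) // {}def_s in rotA rotv *.
case: s rotA rotv => [[_ //]|y s] rotA rotv /=.
by rewrite eqxx => yE; rewrite yE in rotA rotv; exists s.
Qed.

Lemma good_glue A A1 A2 v : A1 :&: A2 = [set v] -> A1 :|: A2 = A ->
    good A1 -> good A2 -> simple_vertex A1 v -> simple_vertex A2 v ->
    ~~ simple_vertex A v ->
    {in A1, forall x, simple_vertex A x -> simple_vertex A1 x} ->
    {in A2, forall x, simple_vertex A x -> simple_vertex A2 x} ->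
  good A.
Proof.
move=> AI AU [c1 c1A v1] [c2 c2A v2] sv1 sv2 nsv sA1 sA2.
have /setIP[vA1 vA2] : v \in A1 :&: A2 by rewrite AI inE.
(* Opposite orientations are chosen at [v]: without their vertical edges, the first cycle is a path
   from [(v, true)] to [(v, false)] and the second a path back. *)
have [s1 [{c1A} [/andP[cc1 uc1] _ mc1] nx1]] :=
  prism_cycle_start false c1A vA1 (v1 v vA1 sv1).
have [s2 [{c2A} [/andP[cc2 uc2] sc2 mc2] nx2]] :=
  prism_cycle_start true c2A vA2 (v2 v vA2 sv2).
move: cc1 uc1 mc1 nx1 cc2 uc2 mc2 nx2 sc2 => /=.
move=> /andP[_ cc1] /and3P[nf1 nt1 us1] mc1 nx1 /andP[_ cc2] /and3P[nt2 nf2 us2] mc2 nx2 sc2.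
have mem1 x b : x != v -> ((x, b) \in s1) = (x \in A1).
  by move=> xv; rewrite -(mc1 x b) !inE !xpair_eqE (negPf xv).
have mem2 x b : x != v -> ((x, b) \in s2) = (x \in A2).
  by move=> xv; rewrite -(mc2 x b) !inE !xpair_eqE (negPf xv).
have v_s1 b : (v, b) \notin s1.
  by case: b; [|move: nf1; rewrite inE negb_or => /andP[]].
have v_s2 b : (v, b) \notin s2.
  by case: b; [move: nt2; rewrite inE negb_or => /andP[]|].
exists ((v, true) :: s1 ++ (v, false) :: s2).
  split.
  - apply/andP; split.
      rewrite /= rcons_cat rcons_cons cat_path /= in cc1 cc2 *.
      by rewrite rcons_path in cc1; case/andP: cc1 => -> ->.
    rewrite /= mem_cat inE (negPf (v_s1 _)) (negPf (v_s2 _)) xpair_eqE eqxx /=.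
    rewrite cat_uniq us1 /= us2 (negPf (v_s1 _)) (negPf (v_s2 _)) !andbT /=.
    apply/hasPn=> -[x b] xs2; have xv : x != v.
      by apply: contraTneq xs2 => ->; apply: v_s2.
    rewrite /= mem1 //; rewrite mem2 // in xs2.
    apply: contra xv => xs1.
    by have : x \in A1 :&: A2; [rewrite inE xs1 | rewrite AI inE].
  - rewrite /= size_cat /= addnS !ltnS.
    by move: sc2; rewrite /= !ltnS => /leq_trans; apply; apply: leq_addl.
  move=> x b; rewrite inE mem_cat inE -AU inE.
  have [->|xv] := eqVneq x v.
    by rewrite vA1 !xpair_eqE eqxx; case: b; rewrite /= ?orbT.
  by rewrite !xpair_eqE (negPf xv) /= mem1 ?mem2.
(* Only the vertical edge at [v] was lost, and [v] is not simple in [A]; all other successors are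
   inherited. *)
move=> x xA sx; have xv : x != v by apply: contraNneq nsv => <-.
move: xA; rewrite -AU inE; have [xA1 _|xA1 /= xA2] := boolP (x \in A1).
  have [b] := nx1 x (v1 x xA1 (sA1 x xA1 sx)).
  rewrite /= xpair_eqE (negPf xv) /= => nxb.
  by exists b; rewrite /= next_at_catl // inE mem1 ?xA1 ?orbT.
have [b] := nx2 x (v2 x xA2 (sA2 x xA2 sx)).
rewrite /= xpair_eqE (negPf xv) /= => nxb.
exists b; rewrite /= next_at_catr // inE mem1 // negb_or xA1 xpair_eqE.
by rewrite (negPf xv).
Qed.

(** * Induction on the number of vertices, splitting at a cutvertex *)

Lemma good_connected A : connected_in e A ->
    (forall B, B \in blocks_in e A -> is_even_cycle e B \/ is_single_edge e B) ->
    (forall x, #|[set B in blocks_in e A | x \in B]| <= 2) ->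
  good A.
Proof.
have [n] := ubnP #|A|; elim: n A => // n IHn A ltA cA bA dA.
have [nA|] := boolP (nonseparable e A).
  apply: good_block; apply: bA; apply/blocks_inP; split=> // C _ sCA sAC.
  by apply/eqP; rewrite eqEsubset sCA.
rewrite /nonseparable cA /= negb_forall => /existsP[v]; rewrite negbK.
case/andP=> vA /exists_inP[x xA /exists_inP[y yA /andP[_ nxy]]].
(* [D1] is the component of [x] after removal of the cutvertex [v]; [D2] collects all other
   components and contains [y]. *)
pose D1 := [set z in A :\ v | connect (induced e (A :\ v)) x z].
pose D2 := (A :\ v) :\: D1.
have sD1 : D1 \subset A :\ v by apply/subsetP=> z; rewrite inE => /andP[].
have sD2 : D2 \subset A :\ v by apply: subsetDl.
have nD1 : D1 != set0 by apply/set0Pn; exists x; rewrite inE xA connect0.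
have yD2 : y \in D2 by apply/setDP; split; rewrite // [_ \in D1]inE yA.
have nD2 : D2 != set0 by apply/set0Pn; exists y.
have cl1 z w : z \in D1 -> w \in A :\ v -> e z w -> w \in D1.
  rewrite 2![_ \in D1]inE => /andP[zA xz] wA ezw; rewrite wA.
  by apply: connect_trans xz (connect1 _); rewrite /induced /= zA wA.
have cl2 z w : z \in D2 -> w \in A :\ v -> e z w -> w \in D2.
  case/setDP=> zA zD wA ezw; apply/setDP; split=> //.
  by apply: contra zD => wD; apply: cl1 wD zA _; rewrite e_sym.
have vD1 : v \notin D1 by apply/negP=> /(subsetP sD1); rewrite !inE eqxx.
have AD1 : A :\: D1 = v |: D2.
  apply/setP=> z; rewrite /D2 in_setU1 !in_setD in_set1.
  by have [->|//] := eqVneq z v; rewrite vD1 vA.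
have AD2 : A :\: D2 = v |: D1.
  apply/setP=> z; rewrite /D2 in_setU1 !in_setD in_set1.
  have [->|zv] := eqVneq z v; first by rewrite andbF vA.
  rewrite /= negb_and negbK; case zD : (z \in D1) => /=; last by rewrite andNb.
  by have /setD1P[] := subsetP sD1 z zD.
have B1 := blocks_in_split_part e_sym e_irr vA cA sD1 nD1 cl1.
have B2 := blocks_in_split_part e_sym e_irr vA cA sD2 nD2 cl2.
(* A common block would lie in [v |: D2], which is [A :\: D1]; [blocks_in_split_part] excludes
   this. *)
have dis B : B \in blocks_in e (v |: D1) -> B \in blocks_in e (v |: D2) -> false.
  by move=> /B1[_]; rewrite AD1 => nB /blocks_inP[_ sB]; rewrite sB in nB.
have sub1 z : [set B in blocks_in e (v |: D1) | z \in B]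
              \subset [set B in blocks_in e A | z \in B].
  by apply/subsetP=> B /setIdP[/B1[BA _] zB]; apply/setIdP.
have sub2 z : [set B in blocks_in e (v |: D2) | z \in B]
              \subset [set B in blocks_in e A | z \in B].
  by apply/subsetP=> B /setIdP[/B2[BA _] zB]; apply/setIdP.
have vcard : #|[set B in blocks_in e (v |: D1) | v \in B]|
           + #|[set B in blocks_in e (v |: D2) | v \in B]|
           <= #|[set B in blocks_in e A | v \in B]|.
  rewrite -cardsUI; set I := _ :&: _.
  suff -> : I = set0.
    by rewrite cards0 addn0 subset_leq_card // subUset sub1 sub2.
  apply/setP=> B; rewrite inE [RHS]inE; apply/negP=> /andP[].
  by case/setIdP=> b1 _ /setIdP[b2 _]; have := dis B b1 b2.
have pos1 : 0 < #|[set B in blocks_in e (v |: D1) | v \in B]|.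
  have [B BD vB] := split_vertex_in_block e D1 v.
  by apply/card_gt0P; exists B; apply/setIdP.
have pos2 : 0 < #|[set B in blocks_in e (v |: D2) | v \in B]|.
  have [B BD vB] := split_vertex_in_block e D2 v.
  by apply/card_gt0P; exists B; apply/setIdP.
(* The two counts at [v] are positive with sum at most 2, hence both are 1: [v] is simple in each
   part but not in [A]. *)
have le2 := leq_trans vcard (dA v).
have part_lt D : D \proper A :\ v -> #|v |: D| < n.
  move=> /proper_card ltD; rewrite -ltnS; apply: leq_trans ltA; rewrite ltnS.
  rewrite (cardsD1 v A) vA; apply: leq_ltn_trans (_ : #|D|.+1 < _) => //.
  by rewrite cardsU1 -add1n leq_add2r leq_b1.
apply: (@good_glue A (v |: D1) (v |: D2) v).
- apply/setP=> z; rewrite /D2 in_setI !in_setU1 in_setD in_set1.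
  by case: (z == v) => //=; case: (z \in D1).
- apply/setP=> z; rewrite -AD1 in_setU in_setU1 in_setD.
  have [->|zv] := eqVneq z v; first by rewrite vA.
  case zD : (z \in D1) => //=.
  by have /setD1P[_ ->] := subsetP sD1 z zD.
- apply: IHn => [||B /B1[/bA] //|z].
  + by apply: part_lt; apply/properP; split=> //; exists y => //; case/setDP: yD2.
  + exact: (connected_split_part e_sym vA cA sD1 cl1).
  + exact: leq_trans (subset_leq_card (sub1 z)) (dA z).
- apply: IHn => [||B /B2[/bA] //|z].
  + apply: part_lt; apply/properP; split=> //; exists x => //.
    by rewrite in_setD [_ \in D1]inE xA connect0.
  + exact: (connected_split_part e_sym vA cA sD2 cl2).
  + exact: leq_trans (subset_leq_card (sub2 z)) (dA z).
- by rewrite /simple_vertex -(leq_add2r 1); apply: leq_trans le2; rewrite leq_add2l.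
- by rewrite /simple_vertex -(leq_add2l 1); apply: leq_trans le2; rewrite leq_add2r.
- by rewrite -ltnNge; apply: leq_trans vcard; apply: leq_add pos1 pos2.
(* Blocks of a part are blocks of [A], so a vertex simple in [A] is simple in its part. *)
- by move=> z _; apply: leq_trans (subset_leq_card (sub1 z)).
- by move=> z _; apply: leq_trans (subset_leq_card (sub2 z)).
Qed.

End Prism.

Theorem theorem2p3 (T : finType) (e : rel T)
    (e_sym : symmetric e) (e_irr : irreflexive e) :
  SBEP e -> hamiltonian (prism e).
Proof.
case=> [[/card_gt0P[x0 _] cT] bT dT].
have [||x|c [uc sc mc] _] := @good_connected T e e_sym e_irr [set: T].
- apply/connected_inP; split=> [|x y _ _]; first by exists x0.
  by rewrite (@eq_connect _ _ e) // => a b; rewrite /induced /= !inE.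
- by move=> B; rewrite blocks_inT; apply: bT.
- rewrite (eq_card (B := [set B | block e B & x \in B])) // => B.
  by rewrite !in_set -blocks_inT inE.
by exists c; split=> // -[x b]; rewrite mc.
Qed.
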